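(* There exists a constant $\beta > 0$ such that for arbitrarily large positive integers $n$ (that is, for every $N$ there is some $n \ge N$) there exist a radius $r$ with $0 < r \le \beta/n$ and a stable configuration of $n$ discs of radius $r$ in the unit square $[0,1]^2$.
   Context: A configuration of $n$ discs of radius $r>0$ in the unit square is a positioning of $n$ non-overlapping discs of radius $r$ contained in $[0,1]^2$; equivalently, a tuple of centers $(x_1,\dots,x_n)$ with each $x_i \in [r,1-r]^2$ and $\|x_i - x_j\| \ge 2r$ (Euclidean norm) for all $i \ne j$ (tangencies between discs and with the walls are allowed). A configuration is stable if each disc is held in place by its neighbors and the walls, meaning that no single disc can move while the others stay fixed: for every $i$ there is $\epsilon > 0$ such that the only point $y \in [r,1-r]^2$ with $\|y - x_i\| < \epsilon$ and $\|y - x_j\| \ge 2r$ for all $j \neq i$ is $y = x_i$. *)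

(* Defs.v *)
From mathcomp Require Import all_boot all_order all_algebra.
From mathcomp Require Import reals.
Set Implicit Arguments.
Unset Strict Implicit.
Unset Printing Implicit Defensive.
Import Order.TTheory GRing.Theory Num.Theory.
Local Open Scope ring_scope.

(* The library norm `|v| on R * R is the sup norm, hence this definition. *)
Definition enorm (R : realType) (v : R * R) : R :=
  Num.sqrt (v.1 ^+ 2 + v.2 ^+ 2).

(* Possible centers of a disc of radius r contained in the unit square. *)
Definition in_square (R : realType) (r : R) (y : R * R) : Prop :=
  r <= y.1 <= 1 - r /\ r <= y.2 <= 1 - r.

Definition configuration (R : realType) (n : nat) (r : R)
    (x : 'I_n -> R * R) : Prop :=
  [/\ 0 < r,
      forall i : 'I_n, in_square r (x i)
    & forall i j : 'I_n, i != j -> 2 * r <= enorm (x i - x j)].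

Definition stable (R : realType) (n : nat) (r : R)
    (x : 'I_n -> R * R) : Prop :=
  forall i : 'I_n, exists eps : R, 0 < eps /\
    forall y : R * R,
      in_square r y ->
      enorm (y - x i) < eps ->
      (forall j : 'I_n, j != i -> 2 * r <= enorm (y - x j)) ->
      y = x i.

(* Main.v *)
(* Discs of radius 1 are placed in a square [0, L]^2 of side L ~ n / 6, which is
   then shrunk.  Three layers of discs run along each side: floor discs touching
   the wall, middle discs resting on two consecutive floor discs, and a chain of
   touching upper discs, each resting on one middle disc.  If the chain is
   strictly convex towards the interior, each upper disc is blocked by its two
   neighbours and its middle disc; a middle disc is the circumcentre of an acute
   triangle formed by two floor discs and an upper disc, hence blocked; a floor
   disc is blocked by the wall and two middle discs.  Convexity forces the upper
   chain to rise a little along the side, which is made possible by gaps between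
   consecutive floor discs.  The configuration is invariant under the
   reflections in both diagonals, so two kinds of corners occur: in one of them
   the chains of the two sides are joined by a contact of their first discs, and
   the corner is filled by a disc touching both walls and two braces; in the
   other one the chains share their last disc, and the floors are held by one
   more disc on the diagonal.  Both corners impose one equation on the chain;
   the second one is used as initial condition and the first one is met by the
   intermediate value theorem.

   A disc is blocked as soon as three of its contact vectors positively span the
   plane, and non-overlap needs to be checked only in one chamber of the
   reflection group. *)
Require Import Defs.
From mathcomp Require Import all_boot all_order all_algebra.
From mathcomp Require Import reals.
From mathcomp Require Import zify ring lra.
From mathcomp Require Import classical_sets topology normedtype realfun.
Set Implicit Arguments.
Unset Strict Implicit.
Unset Printing Implicit Defensive.
Import Order.TTheory GRing.Theory Num.Theory.
Import numFieldNormedType.Exports.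
Local Open Scope ring_scope.

(** * Unit discs in a square of side L, and rescaling *)

Definition dist2 {R : realType} (p q : R * R) : R :=
  (p.1 - q.1) ^+ 2 + (p.2 - q.2) ^+ 2.

Definition cross {R : realType} (m n : R * R) : R := m.1 * n.2 - m.2 * n.1.

Definition in_box {R : realType} (L : R) (p : R * R) : Prop :=
  1 <= p.1 <= L - 1 /\ 1 <= p.2 <= L - 1.

Definition avoids {R : realType} (s : seq (R * R)) (p y : R * R) : Prop :=
  forall q, q \in s -> q != p -> 4 <= dist2 y q.

Definition separated {R : realType} (s : seq (R * R)) : Prop :=
  forall p q, p \in s -> q \in s -> p != q -> 4 <= dist2 p q.

Definition locked {R : realType} (L : R) (s : seq (R * R)) (p : R * R) : Prop :=
  exists e : R, 0 < e /\ forall y,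
    in_box L y -> avoids s p y -> dist2 y p < e -> y = p.

Lemma enorm_ge (R : realType) (a : R) (v : R * R) :
  0 <= a -> (a <= enorm v) = (a ^+ 2 <= v.1 ^+ 2 + v.2 ^+ 2).
Proof.
move=> a0; rewrite /enorm -{1}[a]ger0_norm // -sqrtr_sqr ler_sqrt //.
by rewrite addr_ge0 ?sqr_ge0.
Qed.

Lemma enorm_lt (R : realType) (a : R) (v : R * R) :
  0 < a -> (enorm v < a) = (v.1 ^+ 2 + v.2 ^+ 2 < a ^+ 2).
Proof. by move=> a0; rewrite !ltNge enorm_ge // ltW. Qed.

Lemma rescale_stable (R : realType) (L : R) (s : seq (R * R)) :
  0 < L -> uniq s -> (forall p, p \in s -> in_box L p) -> separated s ->
  (forall p, p \in s -> locked L s p) ->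
  exists x : 'I_(size s) -> R * R,
    configuration L^-1 x /\ stable L^-1 x.
Proof.
move=> L0 us sbox ssep slock.
have Ln : L != 0 by rewrite gt_eqF.
have r0 : 0 < L^-1 by rewrite invr_gt0.
pose z (i : 'I_(size s)) := nth 0 s i.
have zs i : z i \in s by apply: mem_nth.
have zinj i j : i != j -> z i != z j.
  by apply: contraNneq => /eqP; rewrite nth_uniq // => /eqP/val_inj.
exists (fun i => (L^-1 * (z i).1, L^-1 * (z i).2)); split; [split=> //|].
- move=> i; have [/andP[h1 h2] /andP[h3 h4]] := sbox _ (zs i).
  have e : 1 - L^-1 = L^-1 * (L - 1) by field.
  by split; rewrite /= e ler_pM2l // ?h2 ?h4 andbT ler_peMr // ltW.
- move=> i j ij; rewrite enorm_ge /=; last by rewrite mulr_ge0 // ltW.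
  have := ssep _ _ (zs i) (zs j) (zinj _ _ ij); rewrite /dist2 => h.
  rewrite (_ : _ + _ = L^-1 ^+ 2 * ((( z i).1 - (z j).1) ^+ 2 + ((z i).2 - (z j).2) ^+ 2)); last by ring.
  rewrite exprMn mulrC ler_pM2l ?exprn_gt0 //; apply: le_trans h.
  by rewrite expr2; lra.
move=> i; have [e [e0 He]] := slock _ (zs i).
exists (L^-1 * Num.sqrt e); split; first by rewrite mulr_gt0 // sqrtr_gt0.
move=> y [/andP[y1 y2] /andP[y3 y4]] ye yj.
have e1 : 1 - L^-1 = L^-1 * (L - 1) by field.
have yL : forall t, L^-1 * (L * t) = t by move=> t; rewrite mulrA mulVf // mul1r.
have : (L * y.1, L * y.2) = z i.
  apply: He.
  - rewrite /in_box /= -[1 <= _](ler_pM2l r0) -[1 <= L * y.2](ler_pM2l r0).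
    rewrite -[L * y.1 <= _](ler_pM2l r0) -[L * y.2 <= _](ler_pM2l r0).
    by rewrite !yL mulr1 -e1 y1 y2 y3 y4.
  - move=> q qs qz; have iq : (index q s < size s)%N by rewrite index_mem.
    have zq : z (Ordinal iq) = q by rewrite /z nth_index.
    have ne : Ordinal iq != i by apply: contraNneq qz => <-; rewrite zq.
    have := yj _ ne; rewrite enorm_ge /=; last by rewrite mulr_ge0 // ltW.
    rewrite zq /dist2 /= exprMn => h.
    rewrite (_ : _ + _ = L ^+ 2 * ((y.1 - L^-1 * q.1) ^+ 2 + (y.2 - L^-1 * q.2) ^+ 2)); last by field.
    apply: le_trans (ler_wpM2l (sqr_ge0 L) h).
    by rewrite le_eqVlt; apply/orP; left; apply/eqP; field.
  - move: ye; rewrite enorm_lt ?mulr_gt0 ?sqrtr_gt0 //= exprMn sqr_sqrtr ?ltW // => h.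
    rewrite /dist2 /= (_ : _ + _ = L ^+ 2 * ((y.1 - L^-1 * (z i).1) ^+ 2 + (y.2 - L^-1 * (z i).2) ^+ 2)); last by field.
    rewrite -(ltr_pM2l (exprn_gt0 2 L0)) in h.
    by apply: lt_le_trans h _; rewrite le_eqVlt; apply/orP; left; apply/eqP; field.
by move=> <- /=; rewrite !yL -surjective_pairing.
Qed.

(** * Blocking a disc by three contacts *)

(** Equivalent to [|h - m|^2 >= |m|^2]: the displacement [h] does not bring the disc closer to the
    point at offset [m]. *)
Definition blocks {R : realType} (m h : R * R) : Prop :=
  2 * (m.1 * h.1 + m.2 * h.2) <= h.1 ^+ 2 + h.2 ^+ 2.

(** [C1], [C2], [C3] are the positive coefficients of a linear relation between the three vectors.
    Each inner product with [h] is at most [|h|^2 / 2], so by the relation none is very negative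
    either, and all are [O(|h|^2)]. Two independent ones control [|h|], so [|h| = O(|h|^2)], which
    forces a small [h] to vanish. *)
Lemma positively_spanning_blocks (R : realType) (m1 m2 m3 : R * R) :
  0 < cross m1 m2 -> 0 < cross m2 m3 -> 0 < cross m3 m1 ->
  exists e : R, 0 < e /\ forall h : R * R,
    blocks m1 h -> blocks m2 h -> blocks m3 h ->
    h.1 ^+ 2 + h.2 ^+ 2 < e -> h = 0.
Proof.
move=> c3 c1 c2; set C3 := cross m1 m2 in c3; set C1 := cross m2 m3 in c1.
set C2 := cross m3 m1 in c2.
pose M := 1 + (C1 + C2 + C3) / C1 + (C1 + C2 + C3) / C2.
have q1 : 0 < (C1 + C2 + C3) / C1 by apply: divr_gt0 => //; lra.
have q2 : 0 < (C1 + C2 + C3) / C2 by apply: divr_gt0 => //; lra.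
have M0 : 0 < M by rewrite /M; lra.
pose S := m1.1 ^+ 2 + m1.2 ^+ 2 + m2.1 ^+ 2 + m2.2 ^+ 2 + 1.
have S0 : 0 < S by rewrite /S; nra.
have D0 : 0 < 2 * S * M ^+ 2 by rewrite !mulr_gt0 ?exprn_gt0.
exists (C3 ^+ 2 / (2 * S * M ^+ 2)); split; first by rewrite divr_gt0 ?exprn_gt0.
move=> [x y]; rewrite /blocks /=; set q := _ + y ^+ 2 => b1 b2 b3 hq.
set d1 := m1.1 * x + m1.2 * y in b1; set d2 := m2.1 * x + m2.2 * y in b2.
set d3 := m3.1 * x + m3.2 * y in b3.
have q0 : 0 <= q by rewrite /q; nra.
have sum0 : C1 * d1 + C2 * d2 + C3 * d3 = 0.
  by rewrite /C1 /C2 /C3 /cross /d1 /d2 /d3; ring.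
have l1 : - (M * q) <= d1.
  have : - ((C1 + C2 + C3) / C1 * q) <= d1.
    rewrite -(ler_pM2l c1) (_ : C1 * - _ = - ((C1 + C2 + C3) * q)); first by nra.
    by field; rewrite gt_eqF.
  by rewrite /M; nra.
have l2 : - (M * q) <= d2.
  have : - ((C1 + C2 + C3) / C2 * q) <= d2.
    rewrite -(ler_pM2l c2) (_ : C2 * - _ = - ((C1 + C2 + C3) * q)); first by nra.
    by field; rewrite gt_eqF.
  by rewrite /M; nra.
have M1 : 1 <= M by rewrite /M; lra.
have u1 : d1 <= M * q by nra.
have u2 : d2 <= M * q by nra.
have sq1 : d1 ^+ 2 <= (M * q) ^+ 2 by nra.
have sq2 : d2 ^+ 2 <= (M * q) ^+ 2 by nra.
(* By Cramer's rule [C3 * h] is a combination of [d1] and [d2]; the bound is the parallelogram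
   identity with one square dropped. *)
have main : C3 ^+ 2 * q <= 2 * ((m2.1 ^+ 2 + m2.2 ^+ 2) * d1 ^+ 2 + (m1.1 ^+ 2 + m1.2 ^+ 2) * d2 ^+ 2).
  suff -> : C3 ^+ 2 * q = 2 * ((m2.1 ^+ 2 + m2.2 ^+ 2) * d1 ^+ 2 + (m1.1 ^+ 2 + m1.2 ^+ 2) * d2 ^+ 2)
    - ((m2.1 * d1 + m1.1 * d2) ^+ 2 + (m2.2 * d1 + m1.2 * d2) ^+ 2).
    by rewrite lerBlDr lerDl addr_ge0 ?sqr_ge0.
  by rewrite /C3 /cross /d1 /d2 /q; ring.
have main2 : C3 ^+ 2 * q <= 2 * S * (M * q) ^+ 2.
  have A1 : 0 <= m2.1 ^+ 2 + m2.2 ^+ 2 by rewrite addr_ge0 ?sqr_ge0.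
  have A2 : 0 <= m1.1 ^+ 2 + m1.2 ^+ 2 by rewrite addr_ge0 ?sqr_ge0.
  have := ler_wpM2l A1 sq1; have := ler_wpM2l A2 sq2; have := sqr_ge0 (M * q).
  by rewrite /S; nra.
have q00 : q = 0.
  apply/eqP; rewrite eq_le q0 andbT leNgt; apply/negP => qp.
  move: hq; rewrite ltNge => /negP; apply; rewrite ler_pdivrMr //.
  rewrite -(ler_pM2r qp); apply: le_trans main2 _.
  by rewrite le_eqVlt; apply/orP; left; apply/eqP; ring.
have [x0 y0] : x = 0 /\ y = 0.
  by move/eqP: q00; rewrite paddr_eq0 ?sqr_ge0 // !sqrf_eq0 => /andP[/eqP-> /eqP->].
by rewrite x0 y0.
Qed.

(** Only the left and the bottom wall appear: contacts are exhibited for the discs of one chamber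
    and reach the other walls by reflection. *)
Definition contact {R : realType} (s : seq (R * R)) (p m : R * R) : Prop :=
  [\/ (p.1 + m.1, p.2 + m.2) \in s /\ m.1 ^+ 2 + m.2 ^+ 2 = 4,
      p.1 = 1 /\ m = (-1, 0)
    | p.2 = 1 /\ m = (0, -1)].

Lemma contact_blocks (R : realType) (L : R) (s : seq (R * R)) (p m y : R * R) :
  contact s p m -> in_box L y -> avoids s p y -> blocks m (y.1 - p.1, y.2 - p.2).
Proof.
move=> cm [/andP[y1 _] /andP[y2 _]] av; rewrite /blocks /=.
case: cm => [[qs m4]|[p1 ->]|[p2 ->]] /=; last 2 first.
- by have := sqr_ge0 (y.1 - p.1); have := sqr_ge0 (y.2 - p.2); lra.
- by have := sqr_ge0 (y.1 - p.1); have := sqr_ge0 (y.2 - p.2); lra.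
have qp : (p.1 + m.1, p.2 + m.2) != p.
  apply/eqP => e; have := congr1 fst e; have := congr1 snd e => /= e2 e1.
  have [m1 m2] : m.1 = 0 /\ m.2 = 0 by split; lra.
  by move: m4; rewrite m1 m2; lra.
by have := av _ qs qp; rewrite /dist2 /=; nra.
Qed.

Lemma locked_by_contacts (R : realType) (L : R) (s : seq (R * R)) (p m1 m2 m3 : R * R) :
  contact s p m1 -> contact s p m2 -> contact s p m3 ->
  0 < cross m1 m2 -> 0 < cross m2 m3 -> 0 < cross m3 m1 ->
  locked L s p.
Proof.
move=> k1 k2 k3 c3 c1 c2.
have [e [e0 He]] := positively_spanning_blocks c3 c1 c2.
exists e; split=> // y yb ya yd.
have := He (y.1 - p.1, y.2 - p.2) (contact_blocks k1 yb ya)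
  (contact_blocks k2 yb ya) (contact_blocks k3 yb ya) yd.
by case: y p {k1 k2 k3 yb ya yd} => [y1 y2] [p1 p2] /= [] /eqP + /eqP; rewrite !subr_eq0 => /eqP-> /eqP->.
Qed.

(** * Reflections in the diagonals *)

Definition diag_flip {R : realType} (p : R * R) : R * R := (p.2, p.1).

Definition antidiag_flip {R : realType} (L : R) (p : R * R) : R * R :=
  (L - p.2, L - p.1).

(** The two flips commute and generate a Klein four-group; indexed by pairs of booleans, composition
    is componentwise exclusive or. *)
Definition mirror {R : realType} (L : R) (e : bool * bool) (p : R * R) : R * R :=
  let q := if e.2 then antidiag_flip L p else p in
  if e.1 then diag_flip q else q.

(** [undup] is there because a disc centred on a diagonal is its own image under one flip. *)
Definition mirrored {R : realType} (L : R) (B : seq (R * R)) : seq (R * R) :=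
  undup [seq mirror L e p | e <- enum {: bool * bool}, p <- B].

Lemma mirroredP (R : realType) (L : R) (B : seq (R * R)) p :
  reflect (exists e b, b \in B /\ p = mirror L e b) (p \in mirrored L B).
Proof.
rewrite mem_undup; apply: (iffP allpairsP) => [[[e b] [_ bB ->]]|[e [b [bB ->]]]].
  by exists e, b.
by exists (e, b); rewrite mem_enum.
Qed.

Lemma mirror_mirror (R : realType) (L : R) e f (p : R * R) :
  mirror L e (mirror L f p) = mirror L (e.1 (+) f.1, e.2 (+) f.2) p.
Proof.
by case: e f p => [[] []] [[] []] [x y]; rewrite /mirror /diag_flip /antidiag_flip /= ?subKr.
Qed.

Lemma mirror_mirrored (R : realType) (L : R) (B : seq (R * R)) e p :
  p \in mirrored L B -> mirror L e p \in mirrored L B.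
Proof.
move=> /mirroredP[f [b [bB ->]]]; apply/mirroredP.
by exists (e.1 (+) f.1, e.2 (+) f.2), b; rewrite mirror_mirror.
Qed.

Lemma mem_mirrored (R : realType) (L : R) (B : seq (R * R)) p :
  p \in B -> p \in mirrored L B.
Proof. by move=> pB; apply/mirroredP; exists (false, false), p. Qed.

Lemma mirrorK (R : realType) (L : R) e (p : R * R) : mirror L e (mirror L e p) = p.
Proof. by rewrite mirror_mirror !addbb; case: p. Qed.

Lemma dist2_mirror (R : realType) (L : R) e (p q : R * R) :
  dist2 (mirror L e p) (mirror L e q) = dist2 p q.
Proof.
by case: e => [[] []]; rewrite /dist2 /mirror /diag_flip /antidiag_flip /=; ring.
Qed.

Lemma in_box_mirror (R : realType) (L : R) e (p : R * R) :
  in_box L p -> in_box L (mirror L e p).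
Proof.
case: e p => [[] []] [x y] [/= /andP[? ?] /andP[? ?]];
  by split; rewrite /mirror /diag_flip /antidiag_flip /=; apply/andP; split; lra.
Qed.

Lemma locked_mirror (R : realType) (L : R) (B : seq (R * R)) e p :
  locked L (mirrored L B) p -> locked L (mirrored L B) (mirror L e p).
Proof.
move=> [d [d0 Hd]]; exists d; split=> // y yb ya yd.
rewrite -(Hd (mirror L e y)) ?mirrorK //; first exact: in_box_mirror.
  move=> q qs qp; rewrite -(dist2_mirror L e) mirrorK; apply: ya.
    exact: mirror_mirrored.
  by apply: contraNneq qp => h; rewrite -[q](mirrorK L e) h mirrorK.
by rewrite -(dist2_mirror L e) mirrorK.
Qed.

(* A disc centred in the chamber either sits on a diagonal or does not overlap
   its mirror image in it. *)
Definition in_chamber {R : realType} (L : R) (p : R * R) : Prop :=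
  (p.1 = p.2 \/ Num.sqrt 2 <= p.1 - p.2) /\
  (p.1 + p.2 = L \/ Num.sqrt 2 <= L - p.1 - p.2).

(** Each flip of [q] adds twice a product of signed offsets, such as
    [2 * (p.1 - p.2) * (q.1 - q.2)], to the squared distance, and offsets are nonnegative in the
    chamber. *)
Lemma dist2_chamber (R : realType) (L : R) e (p q : R * R) :
  in_chamber L p -> in_chamber L q -> dist2 p q <= dist2 p (mirror L e q).
Proof.
have s2 : 0 <= Num.sqrt 2 :> R by exact: sqrtr_ge0.
move=> [p1 p2] [q1 q2].
have P1 : 0 <= p.1 - p.2 by lra.
have P2 : 0 <= L - p.1 - p.2 by lra.
have Q1 : 0 <= q.1 - q.2 by lra.
have Q2 : 0 <= L - q.1 - q.2 by lra.
have := mulr_ge0 P1 Q1; have := mulr_ge0 P2 Q2.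
by case: e => [[] []]; rewrite /dist2 /mirror /diag_flip /antidiag_flip /=; nra.
Qed.

(** An offset of at least [Num.sqrt 2] puts [p] at distance at least 1 from the diagonal, hence at
    least 2 from its image. *)
Lemma dist2_self_mirror (R : realType) (L : R) e (p : R * R) :
  in_chamber L p -> p != mirror L e p -> 4 <= dist2 p (mirror L e p).
Proof.
have s2 : 0 <= Num.sqrt 2 :> R by exact: sqrtr_ge0.
have s22 : Num.sqrt 2 ^+ 2 = 2 :> R by rewrite sqr_sqrtr.
have sq (t : R) : Num.sqrt 2 <= t -> 2 <= t ^+ 2 by nra.
case: p => x y [/=].
case=> [<-|/sq h1]; (case=> [h2|/sq h2]); case: e => [[] []];
  rewrite /dist2 /mirror /diag_flip /antidiag_flip /= => ne;
  first [by exfalso; case/negP: ne; apply/eqP; congr pair; lra | nra].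
Qed.

Lemma mirrored_separated (R : realType) (L : R) (B : seq (R * R)) :
  (forall p, p \in B -> in_chamber L p) -> separated B -> separated (mirrored L B).
Proof.
move=> ch sep _ _ /mirroredP[e [p [pB ->]]] /mirroredP[f [q [qB ->]]] ne.
rewrite -(dist2_mirror L e) mirrorK mirror_mirror.
have {ne} : p != mirror L (e.1 (+) f.1, e.2 (+) f.2) q.
  by apply: contraNneq ne => ->; rewrite -mirror_mirror mirrorK.
case: (eqVneq p q) => [<-|pq] ne; first by apply: dist2_self_mirror => //; apply: ch.
by apply: le_trans (sep _ _ pB qB pq) _; apply: dist2_chamber; apply: ch.
Qed.

(** Chamber points above the floor lie in the box because [1 <= p.2 <= p.1 <= L - p.2]. *)
Lemma stable_mirrored (R : realType) (L : R) (B : seq (R * R)) :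
  0 < L -> (forall p, p \in B -> in_chamber L p) -> (forall p, p \in B -> 1 <= p.2) ->
  separated B -> (forall p, p \in B -> locked L (mirrored L B) p) ->
  exists x : 'I_(size (mirrored L B)) -> R * R,
    configuration L^-1 x /\ stable L^-1 x.
Proof.
move=> L0 ch ge1 sep lck; apply: rescale_stable => //.
- exact: undup_uniq.
- move=> _ /mirroredP[e [p [pB ->]]]; apply: in_box_mirror.
  have s2 : 0 <= Num.sqrt 2 :> R by exact: sqrtr_ge0.
  have [h1 h2] := ch _ pB; have h3 := ge1 _ pB.
  by split; apply/andP; split; lra.
- exact: mirrored_separated.
by move=> _ /mirroredP[e [p [pB ->]]]; apply: locked_mirror; apply: lck.
Qed.

Lemma size_mirrored (R : realType) (L : R) (B : seq (R * R)) :
  (size (mirrored L B) <= 4 * size B)%N.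
Proof.
apply: leq_trans (size_undup _) _.
by rewrite size_allpairs -cardE card_prod card_bool.
Qed.

(** * Rational bounds for square roots *)

Lemma sqrt2_bounds (R : realType) : 41 / 29 <= Num.sqrt 2 :> R /\ Num.sqrt 2 <= 99 / 70 :> R.
Proof.
have s0 : 0 <= Num.sqrt 2 :> R by exact: sqrtr_ge0.
have s2 : Num.sqrt 2 ^+ 2 = 2 :> R by rewrite sqr_sqrtr.
by split; nra.
Qed.

Lemma sqrt3_bounds (R : realType) : 71 / 41 <= Num.sqrt 3 :> R /\ Num.sqrt 3 <= 97 / 56 :> R.
Proof.
have s0 : 0 <= Num.sqrt 3 :> R by exact: sqrtr_ge0.
have s2 : Num.sqrt 3 ^+ 2 = 3 :> R by rewrite sqr_sqrtr.
by split; nra.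
Qed.

Lemma sqrt6_bounds (R : realType) : 120 / 49 <= Num.sqrt 6 :> R /\ Num.sqrt 6 <= 49 / 20 :> R.
Proof.
have s0 : 0 <= Num.sqrt 6 :> R by exact: sqrtr_ge0.
have s2 : Num.sqrt 6 ^+ 2 = 6 :> R by rewrite sqr_sqrtr.
by split; nra.
Qed.

(** * One backward step along the upper chain *)

(* A base of length 2 admits the apex (1 + p, Y) at circumradius 2 exactly when
   p ^+ 2 = 4 - (Y - sqrt 3) ^+ 2. *)
Lemma circum_factor (R : realType) (p Y : R) :
  ((1 + p) ^+ 2 + Y ^+ 2) * ((1 - p) ^+ 2 + Y ^+ 2) - 16 * Y ^+ 2 =
  (p ^+ 2 - (4 - (Y - Num.sqrt 3) ^+ 2)) * (p ^+ 2 - 1 + Y ^+ 2 + 2 * Num.sqrt 3 * Y).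
Proof.
have : Num.sqrt 3 ^+ 2 = 3 :> R by rewrite sqr_sqrtr.
by set t := Num.sqrt 3 => t2; ring: t2.
Qed.

(* The abscissa X' for which the triangle (0, 0), (X' + m - X, 0), (X', Y) has
   circumradius 2. *)
Definition next_offset {R : realType} (m X Y : R) : R :=
  Y * Num.sqrt (16 / ((m - X) ^+ 2 + Y ^+ 2) - 1).

(** By [circum_factor] the bound on [(X - 1) ^+ 2] says that a base of length 2 with apex [(X, Y0)]
    has circumradius at most 2. It survives the descent by [l], so circumradius 2 is reached only
    over a base of length at least 2, and the new offset inherits the bound. *)
Lemma next_offsetP (R : realType) (l m X Y0 Y : R) :
  91 / 25 <= Y -> Y0 <= 373 / 100 -> Y = Y0 - l -> 0 <= l -> 0 <= m -> m ^+ 2 + l ^+ 2 = 4 ->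
  1 <= X -> (X - 1) ^+ 2 <= 4 - (Y0 - Num.sqrt 3) ^+ 2 ->
  [/\ X + (2 - m) <= next_offset m X Y,
      (next_offset m X Y - 1) ^+ 2 <= 4 - (Y - Num.sqrt 3) ^+ 2
    & (next_offset m X Y ^+ 2 + Y ^+ 2) * ((m - X) ^+ 2 + Y ^+ 2) = 16 * Y ^+ 2].
Proof.
move=> Y1 Y2 eY l0 m0 ml X1 X2.
have s2 : Num.sqrt 3 ^+ 2 = 3 :> R by rewrite sqr_sqrtr.
have [t1 t2] := sqrt3_bounds R.
set t := Num.sqrt 3 in s2 t1 t2 X2 *.
have l1 : l <= 9 / 100 by lra.
have m1 : 2 - l <= m by nra.
have m2 : m <= 2 by nra.
have Xu : X <= 17 / 10 by nra.
(* [1 + p] would be the new offset over a base of length exactly 2. *)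
pose p := X + (2 - m) - 1.
have p0 : 0 <= p by rewrite /p; lra.
have pD : p ^+ 2 <= 4 - (Y - t) ^+ 2.
  have e1 : 2 - m <= l by lra.
  have h1 : p ^+ 2 <= (X - 1 + l) ^+ 2 by rewrite /p; nra.
  by rewrite eY; nra.
set rho := (m - X) ^+ 2 + Y ^+ 2.
have rhoE : rho = (1 - p) ^+ 2 + Y ^+ 2 by rewrite /rho /p; ring.
have Y13 : 66 / 5 <= Y ^+ 2 by nra.
have Y14 : Y ^+ 2 <= 14 by nra.
have p1 : p <= 7 / 10 by nra.
have rho1 : 13 <= rho by rewrite rhoE; have := sqr_ge0 (1 - p); lra.
have p2 : 0 <= p * (2 - p) by apply: mulr_ge0; lra.
have rho2 : rho <= 16.
  have -> : rho = Y ^+ 2 + 1 - p * (2 - p) by rewrite rhoE; ring.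
  by lra.
set X' := next_offset m X Y.
have X'0 : 0 <= X' by apply: mulr_ge0; [lra|exact: sqrtr_ge0].
have X'2 : X' ^+ 2 = Y ^+ 2 * (16 / rho - 1).
  rewrite /X' /next_offset exprMn -/rho sqr_sqrtr // subr_ge0.
  by rewrite ler_pdivlMr; lra.
have rel : (X' ^+ 2 + Y ^+ 2) * rho = 16 * Y ^+ 2.
  by rewrite X'2; field; lra.
have pX : 1 + p <= X'.
  have h := circum_factor p Y; rewrite -/t -rhoE -rel in h.
  have k1 : 0 <= p ^+ 2 - 1 + Y ^+ 2 + 2 * t * Y by nra.
  have k2 : 0 <= (4 - (Y - t) ^+ 2 - p ^+ 2) * (p ^+ 2 - 1 + Y ^+ 2 + 2 * t * Y).
    by apply: mulr_ge0 => //; lra.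
  have k4 : ((1 + p) ^+ 2 - X' ^+ 2) * rho <= 0.
    rewrite (_ : _ * rho = ((1 + p) ^+ 2 + Y ^+ 2) * rho - (X' ^+ 2 + Y ^+ 2) * rho); last by ring.
    by rewrite h; lra.
  rewrite -ler_sqr ?nnegrE; [|lra|exact: X'0].
  have rho0 : 0 < rho by lra.
  by rewrite -subr_le0 -(pmulr_lle0 _ rho0).
split=> //; first by rewrite /p in pX *; lra.
(* Otherwise the base of length 2 below the new apex has circumradius above 2, although
   [(2 - X') ^+ 2 <= (m - X) ^+ 2] bounds it by 2. *)
rewrite leNgt; apply/negP => c.
have X'u : X' <= 17 / 10.
  have : (X' ^+ 2 + Y ^+ 2) * Y ^+ 2 <= 16 * Y ^+ 2.
    rewrite -rel rhoE ler_wpM2l ?addr_ge0 ?sqr_ge0 // lerDr sqr_ge0.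
    by [].
  by rewrite ler_pM2r; nra.
have h := circum_factor (X' - 1) Y; rewrite -/t in h.
have k1 : 0 < (X' - 1) ^+ 2 - 1 + Y ^+ 2 + 2 * t * Y by nra.
have k2 : 0 < ((X' - 1) ^+ 2 - (4 - (Y - t) ^+ 2)) * ((X' - 1) ^+ 2 - 1 + Y ^+ 2 + 2 * t * Y).
  by apply: mulr_gt0 => //; lra.
rewrite -h -rel rhoE in k2.
have k3 : (1 - (X' - 1)) ^+ 2 <= (1 - p) ^+ 2.
  have : 0 <= (X' - 1 - p) * (2 - (X' - 1) - p) by apply: mulr_ge0; lra.
  by lra.
have k4 := ler_wpM2l (addr_ge0 (sqr_ge0 X') (sqr_ge0 Y)) k3.
have e : 1 + (X' - 1) = X' by ring.
by rewrite e in k2; lra.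
Qed.

(** * Backward recursion for the chain *)

(* The upper chain is built from its last disc towards its first one: in this
   direction the offsets increase towards a fixed point, while the map is
   expanding in the other direction. *)
Definition rise {R : realType} (K k : nat) : R :=
  (2 * k%:R + 1) / K%:R ^+ 2 / 200.

Definition run {R : realType} (K k : nat) : R := Num.sqrt (4 - rise K k ^+ 2).

(** A parabola ending at [y], with total rise 1/200 whatever [K] is; its differences [rise] increase
    strictly, which makes the chain convex. *)
Definition height {R : realType} (K : nat) (y : R) (k : nat) : R :=
  y - (1 - (k%:R / K%:R) ^+ 2) / 200.

(** Index [j] stands for disc [K - j]. The initial value solves [chain_circum] under [chain_end],
    since [1 + (2 - sqrt 3) ^+ 2 = 8 - 4 * sqrt 3] and [16 / (8 - 4 * sqrt 3) = 8 + 4 * sqrt 3]. *)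
Fixpoint back_offset {R : realType} (K : nat) (y : R) (j : nat) : R :=
  if j is i.+1 then
    next_offset (run K (K - i.+1)) (back_offset K y i) (height K y (K - i.+1))
  else Num.sqrt (8 + 4 * Num.sqrt 3 - y ^+ 2).

Lemma heightS (R : realType) (K k : nat) (y : R) :
  (0 < K)%N -> height K y k = height K y k.+1 - rise K k.
Proof.
move=> K0; have Kn : K%:R != 0 :> R by rewrite pnatr_eq0 -lt0n.
by rewrite /height /rise -natr1; field.
Qed.

Lemma height_bounds (R : realType) (K k : nat) (y : R) :
  (0 < K)%N -> (k <= K)%N -> y - 1 / 200 <= height K y k <= y.
Proof.
move=> K0 kK; have Kp : 0 < K%:R :> R by rewrite ltr0n.
have h0 : 0 <= k%:R / K%:R :> R by rewrite divr_ge0 ?ler0n.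
have h1 : k%:R / K%:R <= 1 :> R by rewrite ler_pdivrMr // mul1r ler_nat.
by rewrite /height; apply/andP; split; nra.
Qed.

Lemma rise_bounds (R : realType) (K k : nat) :
  (4 <= K)%N -> (k < K)%N -> 0 < (rise K k : R) <= 1 / 400.
Proof.
move=> K4 kK; have K0 : (0 < K)%N by apply: leq_trans K4.
have Kp : 0 < K%:R :> R by rewrite ltr0n.
have k4 : 4 <= K%:R :> R by rewrite (ler_nat _ 4 K).
have k1 : k%:R + 1 <= K%:R :> R by rewrite natr1 ler_nat.
have k0 : 0 <= k%:R :> R by rewrite ler0n.
have K2 : 0 < K%:R ^+ 2 :> R by rewrite exprn_gt0.
apply/andP; split; first by rewrite /rise !divr_gt0 //; lra.
rewrite /rise ler_pdivrMr // ler_pdivrMr //.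
rewrite (_ : 1 / 400 * 200 = 1 / 2); last by field.
by nra.
Qed.

Lemma rise_lt (R : realType) (K k : nat) :
  (0 < K)%N -> rise K k < rise K k.+1 :> R.
Proof.
move=> K0; have Kp : 0 < K%:R :> R by rewrite ltr0n.
rewrite /rise !ltr_pM2r ?invr_gt0 ?exprn_gt0 //.
by rewrite -natr1; lra.
Qed.

Lemma run_sqr (R : realType) (K k : nat) :
  (4 <= K)%N -> (k < K)%N -> run K k ^+ 2 + rise K k ^+ 2 = 4 :> R.
Proof.
move=> K4 kK; have /andP[r0 r1] := @rise_bounds R _ _ K4 kK.
by rewrite /run sqr_sqrtr; [ring|nra].
Qed.

(** At [y = 2 + t] the offset would be exactly 1; the linear bound keeps it away from 1 for smaller
    [y]. *)
Lemma back_offset0 (R : realType) (K : nat) (y : R) :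
  73 / 20 <= y -> y <= 149 / 40 ->
  let t := Num.sqrt 3 in
  let X := back_offset K y 0 in
  [/\ X ^+ 2 + y ^+ 2 = 8 + 4 * t, 1 + 3 * (2 + t - y) <= X
    & (X - 1) ^+ 2 <= 4 - (y - t) ^+ 2].
Proof.
move=> y1 y2; have t2 : Num.sqrt 3 ^+ 2 = 3 :> R by rewrite sqr_sqrtr.
have [t3 t4] := sqrt3_bounds R.
move=> /=; set t := Num.sqrt 3 in t2 t3 t4 *.
have yy : y ^+ 2 <= 8 + 4 * t by nra.
set X := Num.sqrt (8 + _ - _).
have X0 : 0 <= X by exact: sqrtr_ge0.
have X2 : X ^+ 2 = 8 + 4 * t - y ^+ 2 by rewrite sqr_sqrtr // subr_ge0.
have X1 : 1 + 3 * (2 + t - y) <= X.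
  rewrite -ler_sqr ?nnegrE //; last by lra.
  by rewrite X2; nra.
split=> //; first by rewrite X2; ring.
rewrite (_ : (X - 1) ^+ 2 = X ^+ 2 - 2 * X + 1); last by ring.
rewrite X2 (_ : (y - t) ^+ 2 = y ^+ 2 - 2 * y * t + t ^+ 2); last by ring.
by rewrite t2; nra.
Qed.

(** Going backwards the offsets never decrease, so the first bound persists; the second is the
    invariant of [next_offsetP]. *)
Lemma back_offset_inv (R : realType) (K j : nat) (y : R) :
  73 / 20 <= y -> y <= 149 / 40 -> (4 <= K)%N -> (j <= K)%N ->
  1 + 3 * (2 + Num.sqrt 3 - y) <= back_offset K y j /\
  (back_offset K y j - 1) ^+ 2 <= 4 - (height K y (K - j) - Num.sqrt 3) ^+ 2.
Proof.
move=> y1 y2 K4; have K0 : (0 < K)%N by apply: leq_trans K4.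
have [b1 b2 b3] := back_offset0 K y1 y2.
have hK : height K y K = y.
  by rewrite /height divff ?pnatr_eq0 -?lt0n //; ring.
elim: j => [|j IH] jK; first by rewrite subn0 hK.
have [I1 I2] := IH (ltnW jK).
have kK : (K - j.+1 < K)%N by rewrite ltn_subrL K0.
have e : (K - j)%N = (K - j.+1).+1 by rewrite subnSK.
have /andP[r0 r1] := @rise_bounds R _ _ K4 kK.
have rs := @run_sqr R _ _ K4 kK.
have [t3 t4] := sqrt3_bounds R.
have /andP[h1 h2] := height_bounds y K0 (ltnW kK).
have /andP[h3 h4] := height_bounds y K0 (leq_subr j K).
have run2 : run K (K - j.+1) <= 2 :> R by have := sqr_ge0 (rise K (K - j.+1) : R); nra.
rewrite [back_offset _ _ _]/=.
have [] := @next_offsetP R (rise K (K - j.+1)) (run K (K - j.+1)) (back_offset K y j)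
  (height K y (K - j)) (height K y (K - j.+1)) _ _ _ _ _ rs _ I2.
- by lra.
- by lra.
- by rewrite e; apply: heightS.
- by lra.
- exact: sqrtr_ge0.
- by lra.
by move=> n1 n2 _; split => //; lra.
Qed.

(** * Continuity in the final height, and its choice *)

Lemma continuous_height (R : realType) (K k : nat) (y : R) :
  {for y, continuous (fun y : R => height K y k)}.
Proof. by apply: continuousB; [exact: cvg_id | exact: cvg_cst]. Qed.

Lemma continuous_back_offset (R : realType) (K j : nat) (y : R) :
  73 / 20 <= y -> (0 < K)%N -> (j <= K)%N ->
  {for y, continuous (fun y : R => back_offset K y j)}.
Proof.
move=> y1 K0; elim: j => [|j IH] jK.
  apply: (@continuous_comp _ _ _ (fun y : R => 8 + 4 * Num.sqrt 3 - y ^+ 2) Num.sqrt); last exact: sqrt_continuous.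
  apply: continuousB; first exact: cvg_cst.
  by apply: continuousM; exact: cvg_id.
have /andP[h1 _] := height_bounds y K0 (leq_subr j.+1 K).
have cX := IH (ltnW jK).
have cH := @continuous_height R K (K - j.+1) y.
apply: continuousM; first exact: cH.
apply: (@continuous_comp _ _ _ (fun y : R => 16 / ((run K (K - j.+1) - back_offset K y j) ^+ 2 + height K y (K - j.+1) ^+ 2) - 1) Num.sqrt); last exact: sqrt_continuous.
apply: continuousB; last exact: cvg_cst.
apply: continuousM; first exact: cvg_cst.
apply: continuousV.
  by rewrite gt_eqF // ltr_wpDl ?sqr_ge0 // exprn_gt0 //; lra.
have cB : {for y, continuous (fun y : R => run K (K - j.+1) - back_offset K y j)}.
  by apply: continuousB; [exact: cvg_cst | exact: cX].
by apply: continuousD; apply: continuousM.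
Qed.

Lemma exists_start (R : realType) (K : nat) : (4 <= K)%N ->
  exists y : R, [/\ 73 / 20 <= y, y <= 149 / 40 &
    back_offset K y K = height K y 0 - Num.sqrt 6].
Proof.
move=> K4; have K0 : (0 < K)%N by apply: leq_trans K4.
pose F (y : R) := back_offset K y K - (height K y 0 - Num.sqrt 6).
have ab : 73 / 20 <= 149 / 40 :> R by lra.
have cF : {within `[73 / 20, 149 / 40], continuous F}%classic.
  apply: continuous_in_subspaceT => y; rewrite inE /= in_itv /= => /andP[y1 _].
  change {for y, continuous (fun y : R => back_offset K y K - (height K y 0 - Num.sqrt 6))}.
  apply: continuousB; first exact: continuous_back_offset.
  by apply: continuousB; [exact: continuous_height | exact: cvg_cst].
have [t3 t4] := sqrt3_bounds R; have [s3 s4] := sqrt6_bounds R.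
(* Here the offset is at least 1.24 and its target [height K y 0 - Num.sqrt 6] at most 1.21. *)
have F1 : 0 <= F (73 / 20).
  have [I1 _] := back_offset_inv (lexx _) ab K4 (leqnn K).
  have /andP[_ h] := height_bounds (73 / 20 : R) K0 (leq0n K).
  by rewrite /F; lra.
(* Here the invariant keeps the offset below 1.25, and the target is about 1.27. *)
have F2 : F (149 / 40) <= 0.
  have [_ I2] := back_offset_inv ab (lexx _) K4 (leqnn K).
  have /andP[h _] := height_bounds (149 / 40 : R) K0 (leq0n K).
  rewrite subnn in I2.
  by rewrite /F; nra.
have [|y yab Fy] := @IVT R F _ _ 0 ab cF.
  by rewrite ge_min F2 orbT le_max F1.
move: yab; rewrite in_itv /= => /andP[y1 y2]; exists y; split=> //.
by apply/eqP; rewrite -subr_eq0; apply/eqP.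
Qed.

(** * Chains and their existence *)

(* (X k, Y k) is the vector from the k-th floor disc to the k-th upper disc and
   (- a k, Y k) the one from the floor disc k + 1 to the same upper disc;
   chain_circum says that the triangle formed by the three has circumradius 2,
   so that the k-th middle disc fits at its circumcentre.  The conditions
   chain_start and chain_end close the chain up at the two diagonals. *)
Record chain (R : realType) (K : nat) (X Y a : nat -> R) : Prop := Chain {
  chain_Y : forall k, (k <= K)%N -> 91 / 25 <= Y k <= 373 / 100;
  chain_X : forall k, (k <= K)%N -> 1 <= X k <= 17 / 10;
  chain_a : forall k, (k <= K)%N -> 0 < a k <= 1;
  chain_gap : forall k, (k <= K)%N -> 2 <= X k + a k;
  chain_circum : forall k, (k <= K)%N ->
    (X k ^+ 2 + Y k ^+ 2) * (a k ^+ 2 + Y k ^+ 2) = 16 * Y k ^+ 2;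
  chain_edge : forall k, (k < K)%N ->
    (X k.+1 + a k) ^+ 2 + (Y k.+1 - Y k) ^+ 2 = 4;
  chain_run : forall k, (k < K)%N -> 19 / 10 <= X k.+1 + a k;
  chain_rise : forall k, (k < K)%N -> 0 < Y k.+1 - Y k <= 1 / 400;
  chain_convex : forall k, (k.+1 < K)%N -> Y k.+1 - Y k < Y k.+2 - Y k.+1;
  chain_start : X 0%N = Y 0%N - Num.sqrt 6;
  chain_end : a K = (2 - Num.sqrt 3) * Y K;
  chain_end_gap : 1 / 50 <= X K - a K
}.

Lemma exists_chain (R : realType) (K : nat) : (4 <= K)%N ->
  exists X Y a : nat -> R, chain K X Y a.
Proof.
move=> K4; have K0 : (0 < K)%N by apply: leq_trans K4.
have [y [y1 y2 Hy]] := @exists_start R _ K4.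
have [t3 t4] := sqrt3_bounds R.
have [b1 b2 _] := back_offset0 K y1 y2.
pose X k := back_offset K y (K - k); pose Y k := height K y k.
(* For [k < K] this gives the edge its prescribed run; the last value belongs to no edge and is set
   by [chain_end]. *)
pose a k := if (k < K)%N then run K k - X k.+1 else (2 - Num.sqrt 3) * Y K.
have XK : X K = back_offset K y 0 by rewrite /X subnn.
have YK : Y K = y by rewrite /Y /height divff ?pnatr_eq0 -?lt0n //; ring.
have XS k : (k < K)%N -> X k = next_offset (run K k) (X k.+1) (Y k).
  by move=> kK; rewrite /X -(subnSK kK) /= subnSK // subKn // ltnW.
have aS k : (k < K)%N -> a k = run K k - X k.+1 by rewrite /a => ->.
have aK : a K = (2 - Num.sqrt 3) * Y K by rewrite /a ltnn.
have YS k : (k < K)%N -> Y k.+1 - Y k = rise K k.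
  by move=> kK; rewrite /Y [height K y k]heightS //; ring.
have HY k : (k <= K)%N -> 91 / 25 <= Y k <= 373 / 100.
  move=> kK; have /andP[h1 h2] := height_bounds y K0 kK.
  by rewrite /Y; apply/andP; split; lra.
have inv k : (k <= K)%N -> 1 + 3 * (2 + Num.sqrt 3 - y) <= X k /\
    (X k - 1) ^+ 2 <= 4 - (Y k - Num.sqrt 3) ^+ 2.
  move=> kK; have := back_offset_inv y1 y2 K4 (leq_subr k K).
  by rewrite subKn.
have HX k : (k <= K)%N -> 1 <= X k <= 17 / 10.
  move=> kK; have [i1 i2] := inv k kK; have /andP[h1 h2] := HY k kK.
  by apply/andP; split; [lra | clear -i1 i2 h1 h2 t3 t4; nra].
have Hrun k : (k < K)%N -> 19 / 10 <= (run K k : R) <= 2.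
  move=> kK; have /andP[r0 r1] := @rise_bounds R _ _ K4 kK.
  have rs := @run_sqr R _ _ K4 kK.
  have rp : 0 <= run K k :> R by exact: sqrtr_ge0.
  by clear -r0 r1 rs rp; apply/andP; split; nra.
have step k : (k < K)%N ->
    X k.+1 + (2 - run K k) <= X k /\
    (X k ^+ 2 + Y k ^+ 2) * (a k ^+ 2 + Y k ^+ 2) = 16 * Y k ^+ 2.
  move=> kK; rewrite aS // [in X k]XS //.
  have /andP[r0 r1] := @rise_bounds R _ _ K4 kK.
  have /andP[h1 h2] := HY _ (ltnW kK); have /andP[h3 h4] := HY _ kK.
  have /andP[u1 u2] := Hrun k kK; have /andP[x1 _] := HX _ kK.
  have [_ i2] := inv _ kK.
  have [] := @next_offsetP R (rise K k) (run K k) (X k.+1) (Y k.+1) (Y k)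
    _ _ _ _ _ (run_sqr _ K4 kK) _ i2 => //.
  - by rewrite -YS //; ring.
  - by lra.
  - by lra.
exists X, Y, a; split=> //.
- move=> k; rewrite leq_eqVlt => /orP[/eqP->|kK].
    by rewrite aK YK; clear -y1 y2 t3 t4; apply/andP; split; nra.
  rewrite aS //; have /andP[u1 u2] := Hrun k kK; have /andP[x1 x2] := HX _ kK.
  by apply/andP; split; lra.
- move=> k; rewrite leq_eqVlt => /orP[/eqP->|kK].
    by rewrite aK YK XK; clear -b2 y1 y2 t3 t4; nra.
  by rewrite aS //; have [+ _] := step k kK; lra.
- move=> k; rewrite leq_eqVlt => /orP[/eqP->|kK]; last by have [] := step k kK.
  rewrite aK YK XK b1.
  have : Num.sqrt 3 ^+ 2 = 3 :> R by rewrite sqr_sqrtr.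
  by set t := Num.sqrt 3 => t2; ring: t2.
- move=> k kK; rewrite aS // YS // -(run_sqr _ K4 kK); ring.
- move=> k kK; rewrite aS //; have /andP[u1 _] := Hrun k kK; lra.
- by move=> k kK; rewrite YS //; apply: rise_bounds.
- by move=> k kK; rewrite !YS ?(ltnW kK) //; apply: rise_lt.
- by rewrite /X subn0 Hy.
- by rewrite aK XK YK; clear -b2 y1 y2 t3 t4; nra.
Qed.

(** * Geometry of a cell *)

(** The triangle [(0, 0)], [(X + a, 0)], [(X, Y)] has this circumcentre, and squared circumradius
    [(X ^+ 2 + Y ^+ 2) * (a ^+ 2 + Y ^+ 2) / (4 * Y ^+ 2)]. *)
Lemma circumcentre (R : realType) (X Y a : R) :
  Y != 0 -> (X ^+ 2 + Y ^+ 2) * (a ^+ 2 + Y ^+ 2) = 16 * Y ^+ 2 ->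
  ((X + a) / 2) ^+ 2 + ((Y ^+ 2 - a * X) / (2 * Y)) ^+ 2 = 4.
Proof.
move=> Y0 rel; apply: (mulfI (expf_neq0 2 Y0)).
rewrite (_ : Y ^+ 2 * 4 = (16 * Y ^+ 2) / 4); last by field.
by rewrite -rel; field.
Qed.

Lemma circumcentre_apex (R : realType) (X Y a : R) :
  Y != 0 -> (X ^+ 2 + Y ^+ 2) * (a ^+ 2 + Y ^+ 2) = 16 * Y ^+ 2 ->
  (X - (X + a) / 2) ^+ 2 + (Y - (Y ^+ 2 - a * X) / (2 * Y)) ^+ 2 = 4.
Proof. by move=> Y0 rel; rewrite -(circumcentre Y0 rel); field. Qed.

Lemma cell_estimates (R : realType) (X Y a : R) :
  let D := (X + a) / 2 in let h := (Y ^+ 2 - a * X) / (2 * Y) in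
  91 / 25 <= Y <= 373 / 100 -> 1 <= X <= 17 / 10 -> 0 < a <= 1 -> 2 <= X + a ->
  D ^+ 2 + h ^+ 2 = 4 -> (X - D) ^+ 2 + (Y - h) ^+ 2 = 4 ->
  [/\ 1 <= D <= 27 / 20, 7 / 5 <= h <= 7 / 4, 0 <= X - D <= 7 / 10
    & 37 / 20 <= Y - h <= 2].
Proof.
move=> D h /andP[y1 y2] /andP[x1 x2] /andP[a1 a2] g c1 c2.
have d1 : 1 <= D by rewrite /D; lra.
have d2 : D <= 27 / 20 by rewrite /D; lra.
have d3 : 0 <= X - D by rewrite /D; lra.
have h0 : 0 <= h.
  rewrite /h divr_ge0 //; last by lra.
  by clear -y1 y2 x1 x2 a1 a2; nra.
move: D h d1 d2 d3 h0 c1 c2 => D h d1 d2 d3 h0 c1 c2.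
have h1 : 7 / 5 <= h by clear -d1 d2 c1 h0; nra.
have h2 : h <= 26 / 15 by clear -d1 d2 c1 h0; nra.
have s4 : 19 / 10 <= Y - h by lra.
have s1 : Y - h <= 2 by have := sqr_ge0 (X - D); clear -s4 c2; nra.
have d4 : X - D <= 7 / 10 by clear -s4 c2 d3; nra.
by split; apply/andP; split => //; lra.
Qed.

(** The origin, [(- D, h)] and [(t, e)] form an equilateral triangle of side 2. *)
Lemma wedge_estimates (R : realType) (s D h : R) :
  71 / 41 <= s -> s <= 97 / 56 -> s ^+ 2 = 3 -> D ^+ 2 + h ^+ 2 = 4 ->
  1 <= D <= 27 / 20 -> 7 / 5 <= h <= 7 / 4 ->
  let t := (s * h - D) / 2 in let e := (s * D + h) / 2 in
  [/\ 53 / 100 <= t <= 21 / 20, 3 / 2 <= e <= 21 / 10,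
  t ^+ 2 + e ^+ 2 = 4, (D + t) ^+ 2 + (h - e) ^+ 2 = 4 & t < e].
Proof.
move=> s1 s3 ss c1 /andP[d1 d2] /andP[h1 h2] t e.
have t1 : 53 / 100 <= t by rewrite /t; clear -s1 d1 d2 h1 h2; nra.
have t2 : t <= 21 / 20 by rewrite /t; clear -s3 d1 d2 h1 h2; nra.
have e1 : 3 / 2 <= e by rewrite /e; clear -s1 d1 d2 h1 h2; nra.
have e2 : e <= 21 / 10 by rewrite /e; clear -s3 d1 d2 h1 h2; nra.
split; [by apply/andP|by apply/andP| | |lra].
  by rewrite -c1 /t /e; field: ss.
by rewrite -c1 /t /e; field: ss.
Qed.

(** * Coordinates of the discs *)

Section Chain.

Variables (R : realType) (K : nat) (X Y a : nat -> R).
Hypothesis HK : (0 < K)%N.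
Hypothesis H : chain K X Y a.

Let s2 : R := Num.sqrt 2.
Let s3 : R := Num.sqrt 3.
Let s6 : R := Num.sqrt 6.

Let D k := (X k + a k) / 2.
Let h k := (Y k ^+ 2 - a k * X k) / (2 * Y k).
(** The first floor disc is at [1 + 2 * P], so that the brace touches both it and the corner
    disc. *)
Let wx k : R := 1 + (s6 + s2) + \sum_(i < k) (X i + a i).
Let ux k : R := wx k + X k.

(* P = 2 cos (15 deg), Q = 2 sin (15 deg) *)
Let P : R := (s6 + s2) / 2.
Let Q : R := (s6 - s2) / 2.
(* (t, e) is the vector (- D K, h K) turned by -60 degrees. *)
Let t : R := (s3 * h K - D K) / 2.
Let e : R := (s3 * D K + h K) / 2.

(** Chosen so that [upper K] lies on the antidiagonal. *)
Definition side : R := ux K + 1 + Y K.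
Let L := side.

Definition corner : R * R := (1, 1).
(** Seen from the corner at 15 degrees, so that corner, brace and the mirror image of the brace form
    an equilateral triangle. *)
Definition brace : R * R := (1 + P, 1 + Q).
Definition floor k : R * R := (wx k, 1).
Definition middle k : R * R := (wx k + D k, 1 + h k).
Definition upper k : R * R := (ux k, 1 + Y k).
Definition wedge : R * R := (wx K.+1 + t, 1 + e).

Definition base : seq (R * R) :=
  [:: corner; brace; wedge] ++ [seq floor k | k <- iota 0 K.+2] ++
  [seq middle k | k <- iota 0 K.+1] ++ [seq upper k | k <- iota 0 K.+1].

Lemma sqrt_facts : [/\ s2 ^+ 2 = 2, s6 ^+ 2 = 6, s3 ^+ 2 = 3,
  [/\ 41 / 29 <= s2 & s2 <= 99 / 70] & [/\ 120 / 49 <= s6, s6 <= 49 / 20, 71 / 41 <= s3 & s3 <= 97 / 56]].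
Proof.
have [? ?] := sqrt2_bounds R; have [? ?] := sqrt3_bounds R; have [? ?] := sqrt6_bounds R.
by split=> //; rewrite sqr_sqrtr.
Qed.

Lemma cell_circle k : (k <= K)%N -> D k ^+ 2 + h k ^+ 2 = 4 /\ (X k - D k) ^+ 2 + (Y k - h k) ^+ 2 = 4.
Proof.
move=> kK; have /andP[y1 _] := chain_Y H kK.
have Y0 : Y k != 0 by rewrite gt_eqF //; lra.
split; first exact: circumcentre (chain_circum H kK).
exact: circumcentre_apex (chain_circum H kK).
Qed.

Lemma cell_bounds k : (k <= K)%N ->
  [/\ 1 <= D k <= 27 / 20, 7 / 5 <= h k <= 7 / 4, 0 <= X k - D k <= 7 / 10
    & 37 / 20 <= Y k - h k <= 2].
Proof.
move=> kK; have [c1 c2] := cell_circle kK.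
exact: cell_estimates (chain_Y H kK) (chain_X H kK) (chain_a H kK) (chain_gap H kK) c1 c2.
Qed.

Lemma wxS k : wx k.+1 = wx k + 2 * D k.
Proof. by rewrite /wx big_ord_recr /= /D; field. Qed.

Lemma wx_mono j k : (j < k)%N -> (k <= K.+1)%N -> wx j.+1 <= wx k.
Proof.
elim: k => // k IH; rewrite ltnS leq_eqVlt => /orP[/eqP->//|jk] kK.
apply: le_trans (IH jk (ltnW kK)) _.
by rewrite wxS; have [/andP[d1 _] _ _ _] := cell_bounds (k := k) kK; lra.
Qed.

Lemma wx0 : wx 0 = 1 + s6 + s2.
Proof. by rewrite /wx big_ord0; ring. Qed.

Lemma wx_ge0 k : (k <= K.+1)%N -> wx 0 <= wx k.
Proof.
case: k => // k kK; apply: le_trans (wx_mono (ltn0Sn k) kK).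
by rewrite wxS; have [/andP[d1 _] _ _ _] := cell_bounds (leq0n K); lra.
Qed.

Lemma uxS k : (k < K)%N -> ux k.+1 = ux k + (X k.+1 + a k).
Proof. by move=> kK; rewrite /ux wxS /D; field. Qed.

Lemma ux_mono j k : (j < k)%N -> (k <= K)%N -> ux j + 19 / 10 <= ux k.
Proof.
elim: k => // k IH; rewrite ltnS leq_eqVlt => /orP[/eqP->|jk] kK.
  by rewrite uxS //; have := chain_run H kK; lra.
by rewrite uxS //; have := chain_run H kK; have := IH jk (ltnW kK); lra.
Qed.

(** The circle of radius 2 about [middle K] passes through [floor K.+1], [upper K] and [wedge]. From
    [upper K] the last chord, [floor K.+1] to [wedge], is seen under 30 degrees; by [chain_end] the
    direction to [floor K.+1] is 15 degrees off the vertical, so the direction to [wedge] is at 45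
    degrees. *)
Lemma wedge_antidiag : wedge.1 + wedge.2 = L.
Proof.
have [_ _ e3 _ [_ _ s3l _]] := sqrt_facts.
have hE : h K = (Y K - (2 - s3) * X K) / 2.
  have /andP[y1 _] := chain_Y H (leqnn K).
  by rewrite /h (chain_end H) -/s3; field; rewrite gt_eqF //; lra.
rewrite /L /side /ux /wedge /= wxS /t /e hE /D (chain_end H) -/s3.
by field: e3.
Qed.

Lemma wedge_bounds : [/\ 53 / 100 <= t <= 21 / 20, 3 / 2 <= e <= 21 / 10,
  t ^+ 2 + e ^+ 2 = 4, (D K + t) ^+ 2 + (h K - e) ^+ 2 = 4 & t < e].
Proof.
have [_ _ e3 _ [_ _ s3l s3u]] := sqrt_facts.
have [c1 _] := cell_circle (leqnn K); have [bD bh _ _] := cell_bounds (leqnn K).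
exact: wedge_estimates s3l s3u e3 c1 bD bh.
Qed.

Variant base_view : R * R -> Prop :=
  | BaseCorner : base_view corner
  | BaseBrace : base_view brace
  | BaseWedge : base_view wedge
  | BaseFloor k of (k <= K.+1)%N : base_view (floor k)
  | BaseMiddle k of (k <= K)%N : base_view (middle k)
  | BaseUpper k of (k <= K)%N : base_view (upper k).

Lemma baseP p : p \in base -> base_view p.
Proof.
rewrite !mem_cat => /or4P[|/mapP[k + ->]|/mapP[k + ->]|/mapP[k + ->]].
- by rewrite !inE => /or3P[]/eqP->; constructor.
all: by rewrite mem_iota add0n => /andP[_ kK]; constructor.
Qed.

Lemma mem_floor k : (k <= K.+1)%N -> floor k \in base.
Proof.
by move=> kK; rewrite !mem_cat (map_f floor) ?orbT // mem_iota.
Qed.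

Lemma mem_middle k : (k <= K)%N -> middle k \in base.
Proof.
by move=> kK; rewrite !mem_cat (map_f middle) ?orbT // mem_iota.
Qed.

Lemma mem_upper k : (k <= K)%N -> upper k \in base.
Proof.
by move=> kK; rewrite !mem_cat (map_f upper) ?orbT // mem_iota.
Qed.

(** * Distances between discs of the chamber *)

Lemma far_x (p q : R * R) : p.1 + 2 <= q.1 -> 4 <= dist2 p q.
Proof. by move=> pq; rewrite /dist2; have := sqr_ge0 (p.2 - q.2); nra. Qed.

Lemma dist2C (p q : R * R) : dist2 p q = dist2 q p.
Proof. by rewrite /dist2; ring. Qed.

Lemma PQ_facts : [/\ P ^+ 2 + Q ^+ 2 = 4, P - Q = s2, 19 / 10 <= P <= 2, 1 / 2 <= Q <= 1 & wx 0 = 1 + 2 * P].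
Proof.
have [e2 e6 e3 [s2l s2u] [s6l s6u _ _]] := sqrt_facts.
split; rewrite ?wx0 /P /Q; first by field: e2 e6.
- by field.
- by apply/andP; split; lra.
- by apply/andP; split; lra.
- by field.
Qed.

Lemma far_corner p : base_view p -> p != corner -> 4 <= dist2 corner p.
Proof.
have [c _ /andP[P1 P2] /andP[Q1 Q2] w0] := PQ_facts.
case=> [||_|k kK _|k kK _|k kK _]; first by rewrite eqxx.
- by move=> _; rewrite -c /dist2 /= le_eqVlt; apply/orP; left; apply/eqP; ring.
- apply: far_x => /=; have [/andP[t1 _] _ _ _ _] := wedge_bounds.
  by have := wx_ge0 (leqnn K.+1); lra.
- by apply: far_x => /=; have := wx_ge0 kK; lra.
- apply: far_x => /=; have [/andP[d1 _] _ _ _] := cell_bounds kK.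
  by have := wx_ge0 (leqW kK); lra.
- apply: far_x; rewrite /= /ux; have /andP[x1 _] := chain_X H kK.
  by have := wx_ge0 (leqW kK); lra.
Qed.

Lemma far_brace p : base_view p -> p != brace -> 4 <= dist2 brace p.
Proof.
have [c _ /andP[P1 P2] /andP[Q1 Q2] w0] := PQ_facts.
case=> [|||k kK _|k kK _|k kK _].
- by move=> _; rewrite -c /dist2 /= le_eqVlt; apply/orP; left; apply/eqP; ring.
- by rewrite eqxx.
- move=> _; apply: far_x => /=; have [/andP[t1 _] _ _ _ _] := wedge_bounds.
  by have := wx_ge0 (leqnn K.+1); lra.
- case: k kK => [|k] kK.
    by rewrite -c /dist2 /= w0 le_eqVlt; apply/orP; left; apply/eqP; ring.
  apply: far_x => /=; have := wx_mono (ltn0Sn k) kK; rewrite wxS.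
  by have [/andP[d1 _] _ _ _] := cell_bounds (leq0n K); lra.
- apply: far_x => /=; have [/andP[d1 _] _ _ _] := cell_bounds kK.
  by have := wx_ge0 (leqW kK); lra.
- apply: far_x; rewrite /= /ux; have /andP[x1 _] := chain_X H kK.
  by have := wx_ge0 (leqW kK); lra.
Qed.

Lemma far_floor_floor j k : (j < k)%N -> (k <= K.+1)%N -> 4 <= dist2 (floor j) (floor k).
Proof.
move=> jk kK; apply: far_x => /=; have := wx_mono jk kK; rewrite wxS.
have jK : (j <= K)%N by rewrite -ltnS; apply: leq_trans kK.
by have [/andP[d1 _] _ _ _] := cell_bounds jK; lra.
Qed.

Lemma far_floor_middle j k : (j <= K.+1)%N -> (k <= K)%N -> 4 <= dist2 (floor j) (middle k).
Proof.
move=> jK kK; have [/andP[d1 _] _ _ _] := cell_bounds kK.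
have [c _] := cell_circle kK.
case: (ltngtP j k) => [jk|kj|->].
- apply: far_x => /=; have := wx_mono jk (leqW kK); rewrite wxS.
  by have [/andP[d2 _] _ _ _] := cell_bounds (ltnW (leq_trans jk kK)); lra.
- move: kj; rewrite leq_eqVlt => /orP[/eqP<-|kj].
    by rewrite -c /dist2 /= wxS le_eqVlt; apply/orP; left; apply/eqP; ring.
  rewrite dist2C; apply: far_x => /=; have := wx_mono kj jK; rewrite !wxS.
  have k1K : (k.+1 <= K)%N by rewrite -ltnS; apply: leq_trans jK.
  by have [/andP[d2 _] _ _ _] := cell_bounds k1K; lra.
- by rewrite -c /dist2 /= le_eqVlt; apply/orP; left; apply/eqP; ring.
Qed.

Lemma far_floor_upper j k : (k <= K)%N -> 4 <= dist2 (floor j) (upper k).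
Proof.
move=> kK; have /andP[y1 _] := chain_Y H kK; rewrite /dist2 /=.
by have := sqr_ge0 (wx j - ux k); nra.
Qed.

Lemma far_middle_middle j k : (j < k)%N -> (k <= K)%N -> 4 <= dist2 (middle j) (middle k).
Proof.
move=> jk kK; apply: far_x => /=; have := wx_mono jk (leqW kK); rewrite wxS.
have [/andP[d1 _] _ _ _] := cell_bounds kK.
by have [/andP[d2 _] _ _ _] := cell_bounds (ltnW (leq_trans jk kK)); lra.
Qed.

Lemma far_middle_upper j k : (j <= K)%N -> (k <= K)%N -> 4 <= dist2 (middle j) (upper k).
Proof.
move=> jK kK; have [_ /andP[h1 h2] /andP[x1 x2] /andP[s1 s4]] := cell_bounds jK.
have [_ c] := cell_circle jK; have /andP[y1 y2] := chain_Y H kK.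
have [_ /andP[_ h3] _ _] := cell_bounds jK.
case: (ltngtP j k) => [jk|kj|<-].
- have := ux_mono jk kK; rewrite /dist2 /= /ux => u.
  have u1 : 9 / 5 <= wx k + X k - (wx j + D j) by lra.
  have u2 : 9 / 5 <= Y k - h j by lra.
  by nra.
- have := ux_mono kj jK; rewrite /dist2 /= /ux => u.
  have u1 : 6 / 5 <= wx j + D j - (wx k + X k) by lra.
  have u2 : 9 / 5 <= Y k - h j by lra.
  by nra.
- by rewrite -c /dist2 /= /ux le_eqVlt; apply/orP; left; apply/eqP; ring.
Qed.

Lemma far_upper_upper j k : (j < k)%N -> (k <= K)%N -> 4 <= dist2 (upper j) (upper k).
Proof.
rewrite leq_eqVlt => /orP[/eqP<- kK|jk kK].
  rewrite -(chain_edge H kK) /dist2 /= uxS //.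
  by rewrite le_eqVlt; apply/orP; left; apply/eqP; ring.
apply: far_x => /=; have jk' := ltnW jk.
have := ux_mono (ltnSn j) (leq_trans jk' kK).
by have := ux_mono jk kK; lra.
Qed.

Lemma far_wedge p : base_view p -> p != wedge -> 4 <= dist2 p wedge.
Proof.
have [/andP[t1 t2] /andP[e1 e2] c c' te] := wedge_bounds.
have [/andP[d1 d2] /andP[h1 h2] /andP[x1 x2] _] := cell_bounds (leqnn K).
have wK := wxS K.
(* [upper K] and [wedge] both lie on the antidiagonal, so their squared distance is twice the square
   of this horizontal one. *)
have A : 3 / 2 <= wx K.+1 + t - ux K.
  have [_ _ _ _ [_ _ s3l s3u]] := sqrt_facts; have /andP[y1 y2] := chain_Y H (leqnn K).
  have aK : 97 / 100 <= a K by rewrite (chain_end H) -/s3; nra.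
  rewrite (_ : wx K.+1 + t - ux K = a K + t); first by lra.
  by rewrite /ux wK /D; field.
case=> [|||k kK|k kK|k kK] ne; last 3 first.
- move: kK; rewrite leq_eqVlt => /orP[/eqP->|kK].
    by rewrite -c /dist2 /= le_eqVlt; apply/orP; left; apply/eqP; ring.
  apply: far_x => /=; have := wx_mono kK (leqnn _); rewrite wxS.
  by have [/andP[d3 _] _ _ _] := cell_bounds (k := k) kK; lra.
- move: kK; rewrite leq_eqVlt => /orP[/eqP->|kK].
    by rewrite -c' /dist2 /= wK le_eqVlt; apply/orP; left; apply/eqP; ring.
  apply: far_x => /=; have := wx_mono kK (leqnSn K); rewrite wxS.
  by have [/andP[d3 _] _ _ _] := cell_bounds (ltnW kK); lra.
- move: kK; rewrite leq_eqVlt => /orP[/eqP->|kK].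
    have B : Y K - e = wx K.+1 + t - ux K.
      by have := wedge_antidiag; rewrite /L /side /=; lra.
    rewrite /dist2 /= (_ : _ + _ = 2 * (wx K.+1 + t - ux K) ^+ 2); first by nra.
    rewrite (_ : 1 + Y K - (1 + e) = wx K.+1 + t - ux K); first by ring.
    by rewrite -B; ring.
  by apply: far_x => /=; have := ux_mono kK (leqnn K); lra.
- by apply: far_corner; [exact: BaseWedge | rewrite eq_sym].
- by apply: far_brace; [exact: BaseWedge | rewrite eq_sym].
- by rewrite eqxx in ne.
Qed.

Lemma base_separated : separated base.
Proof.
move=> p q /baseP vp /baseP vq.
case: vp => [|||j jK|j jK|j jK] pq.
- by apply: far_corner => //; rewrite eq_sym.
- by apply: far_brace => //; rewrite eq_sym.
- by rewrite dist2C; apply: far_wedge => //; rewrite eq_sym.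
- have vp := BaseFloor jK.
  case: vq pq => [|||k kK|k kK|k kK] pq; rewrite 1?[dist2 _ corner]dist2C 1?[dist2 _ brace]dist2C.
  + exact: far_corner.
  + exact: far_brace.
  + exact: far_wedge.
  + case: (ltngtP j k) pq => [jk|kj|->] pq; [exact: far_floor_floor| |by rewrite eqxx in pq].
    by rewrite dist2C; apply: far_floor_floor.
  + exact: far_floor_middle.
  + exact: far_floor_upper.
- have vp := BaseMiddle jK.
  case: vq pq => [|||k kK|k kK|k kK] pq; rewrite 1?[dist2 _ corner]dist2C 1?[dist2 _ brace]dist2C.
  + exact: far_corner.
  + exact: far_brace.
  + exact: far_wedge.
  + by rewrite dist2C; apply: far_floor_middle.
  + case: (ltngtP j k) pq => [jk|kj|->] pq; [exact: far_middle_middle| |by rewrite eqxx in pq].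
    by rewrite dist2C; apply: far_middle_middle.
  + exact: far_middle_upper.
- have vp := BaseUpper jK.
  case: vq pq => [|||k kK|k kK|k kK] pq; rewrite 1?[dist2 _ corner]dist2C 1?[dist2 _ brace]dist2C.
  + exact: far_corner.
  + exact: far_brace.
  + exact: far_wedge.
  + by rewrite dist2C; apply: far_floor_upper.
  + by rewrite dist2C; apply: far_middle_upper.
  + case: (ltngtP j k) pq => [jk|kj|->] pq; [exact: far_upper_upper| |by rewrite eqxx in pq].
    by rewrite dist2C; apply: far_upper_upper.
Qed.

(** * Position in the chamber *)

Lemma side_ge : wx K + 28 / 5 <= L.
Proof.
rewrite /L /side /ux; have /andP[y1 _] := chain_Y H (leqnn K).
by have /andP[x1 _] := chain_X H (leqnn K); lra.
Qed.

(** Equality holds at [k = 0] by [chain_start]; further on each edge runs at least 19/10 while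
    heights differ by less than 1/10. *)
Lemma upper_diag k : (k <= K)%N -> s2 <= ux k - Y k - 1.
Proof.
move=> kK; have u0 : ux 0 - Y 0 - 1 = s2.
  by rewrite /ux (chain_start H) wx0 -/s6; ring.
case: k kK => [|k] kK; first by rewrite u0.
have := ux_mono (ltn0Sn k) kK; have /andP[y1 _] := chain_Y H (leq0n K).
by have /andP[_ y2] := chain_Y H kK; lra.
Qed.

Lemma base_chamber p : base_view p -> in_chamber L p.
Proof.
have [c PQ /andP[P1 P2] /andP[Q1 Q2] w0] := PQ_facts.
have [_ _ _ [s2l s2u] _] := sqrt_facts; have sd := side_ge.
have wK := wx_ge0 (leqnSn K).
rewrite /in_chamber -/s2; case=> [|||k kK|k kK|k kK] /=.
- by split; [left | right; lra].
- by split; right; lra.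
- have [/andP[t1 t2] /andP[e1 e2] _ _ _] := wedge_bounds.
  split; last by left; exact: wedge_antidiag.
  by right; have := wx_ge0 (leqnn K.+1); lra.
- split; right; first by have := wx_ge0 kK; lra.
  have : wx k <= wx K + 2 * D K.
    by move: kK; rewrite -wxS leq_eqVlt => /orP[/eqP->//|kK]; have := wx_mono kK (leqnn _);
    have [/andP[d3 _] _ _ _] := cell_bounds (k := k) kK; rewrite [wx k.+1]wxS; lra.
  rewrite /L /side /ux /D; have /andP[y1 _] := chain_Y H (leqnn K).
  by have /andP[a1 a2] := chain_a H (leqnn K); lra.
- have [/andP[d1 d2] /andP[h1 h2] _ _] := cell_bounds kK.
  split; right; first by have := wx_ge0 (leqW kK); lra.
  move: kK; rewrite leq_eqVlt => /orP[/eqP kK|kK].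
    rewrite kK in d1 d2 h1 h2 *; rewrite /L /side /ux.
    have /andP[y1 _] := chain_Y H (leqnn K).
    by have [_ _ /andP[x1 _] _] := cell_bounds (leqnn K); lra.
  by have := wx_mono kK (leqnSn K); rewrite wxS; lra.
- split; first by right; have := upper_diag kK; lra.
  move: kK; rewrite leq_eqVlt => /orP[/eqP->|kK]; first by left; rewrite /L /side; ring.
  right; rewrite /L /side; have := ux_mono kK (leqnn K).
  have /andP[y1 _] := chain_Y H (leqnn K).
  by have /andP[_ y2] := chain_Y H (ltnW kK); lra.
Qed.

Lemma base_ge1 p : base_view p -> 1 <= p.2.
Proof.
case=> [|||k kK|k kK|k kK] //=; rewrite lerDl.
- by have [_ _ _ /andP[Q1 _] _] := PQ_facts; lra.
- by have [_ /andP[e1 _] _ _ _] := wedge_bounds; lra.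
- by have [_ /andP[h1 _] _ _] := cell_bounds kK; lra.
- by have /andP[y1 _] := chain_Y H kK; lra.
Qed.

(** * Contacts and locking *)

Let S := mirrored L base.

Lemma contact_point (p m q : R * R) :
  q \in S -> p.1 + m.1 = q.1 -> p.2 + m.2 = q.2 -> m.1 ^+ 2 + m.2 ^+ 2 = 4 ->
  contact S p m.
Proof. by move=> qS e1 e2 m4; apply: Or31; rewrite e1 e2 -surjective_pairing. Qed.

Lemma diag_mem q : q \in S -> (q.2, q.1) \in S.
Proof. exact: (@mirror_mirrored R L base (true, false) q). Qed.

Lemma antidiag_mem q : q \in S -> (L - q.2, L - q.1) \in S.
Proof. exact: (@mirror_mirrored R L base (false, true) q). Qed.

Lemma corner_mem : corner \in S.
Proof. by apply: mem_mirrored; rewrite !inE eqxx. Qed.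

Lemma brace_mem : brace \in S.
Proof. by apply: mem_mirrored; rewrite !inE eqxx orbT. Qed.

Lemma wedge_mem : wedge \in S.
Proof. by apply: mem_mirrored; rewrite !inE eqxx !orbT. Qed.

Lemma floor_mem k : (k <= K.+1)%N -> floor k \in S.
Proof. by move=> kK; apply/mem_mirrored/mem_floor. Qed.

Lemma middle_mem k : (k <= K)%N -> middle k \in S.
Proof. by move=> kK; apply/mem_mirrored/mem_middle. Qed.

Lemma upper_mem k : (k <= K)%N -> upper k \in S.
Proof. by move=> kK; apply/mem_mirrored/mem_upper. Qed.

Lemma floor_contact_right k : (k <= K)%N -> contact S (floor k) (D k, h k).
Proof.
move=> kK; apply: (contact_point (middle_mem kK)) => //=.
by have [] := cell_circle kK.
Qed.

Lemma floor_contact_left k : (k <= K)%N -> contact S (floor k.+1) (- D k, h k).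
Proof.
move=> kK; apply: (contact_point (middle_mem kK)) => //=; first by rewrite wxS; ring.
by have [c _] := cell_circle kK; rewrite -c; ring.
Qed.

Lemma floor_contact_wall k : contact S (floor k) (0, -1).
Proof. exact: Or33. Qed.

Lemma locked_corner : locked L S corner.
Proof.
have [c PQ /andP[P1 P2] /andP[Q1 Q2] w0] := PQ_facts.
apply: (@locked_by_contacts R L S corner (-1, 0) (0, -1) (P, Q)); rewrite /cross /=; try lra.
- exact: Or32.
- exact: Or33.
- exact: (contact_point brace_mem).
Qed.

Lemma locked_brace : locked L S brace.
Proof.
have [c PQ /andP[P1 P2] /andP[Q1 Q2] w0] := PQ_facts.
have [e2 _ _ [s2l s2u] _] := sqrt_facts.
apply: (@locked_by_contacts R L S brace (- P, - Q) (P, - Q) (- s2, s2)); rewrite /cross /=.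
- by apply: (contact_point corner_mem) => /=; [ring|ring|rewrite -c; ring].
- by apply: (contact_point (floor_mem (leq0n _))) => /=; [rewrite w0; ring|ring|rewrite -c; ring].
- by apply: (contact_point (diag_mem brace_mem)) => /=; [lra|lra|ring: e2].
- by nra.
- by nra.
- by nra.
Qed.

Lemma locked_floor k : (k <= K.+1)%N -> locked L S (floor k).
Proof.
case: k => [_|k].
  have [c PQ /andP[P1 P2] /andP[Q1 Q2] w0] := PQ_facts.
  have [/andP[d1 _] /andP[h1 _] _ _] := cell_bounds (leq0n K).
  apply: (@locked_by_contacts R L S _ (0, -1) (D 0, h 0) (- P, Q)); rewrite /cross /=.
  - exact: floor_contact_wall.
  - exact: floor_contact_right.
  - by apply: (contact_point brace_mem) => //=; [rewrite w0; ring | rewrite -c; ring].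
  - by lra.
  - by nra.
  - by lra.
rewrite ltnS leq_eqVlt => /orP[/eqP->|kK].
  have [/andP[t1 t2] /andP[e1 e2] c _ te] := wedge_bounds.
  have [/andP[d1 _] /andP[h1 _] _ _] := cell_bounds (leqnn K).
  apply: (@locked_by_contacts R L S _ (0, -1) (t, e) (- D K, h K)); rewrite /cross /=.
  - exact: floor_contact_wall.
  - exact: (contact_point wedge_mem).
  - exact: floor_contact_left.
  - by lra.
  - by nra.
  - by lra.
have [/andP[d1 _] /andP[h1 _] _ _] := cell_bounds (ltnW kK).
have [/andP[d2 _] /andP[h2 _] _ _] := cell_bounds kK.
apply: (@locked_by_contacts R L S _ (0, -1) (D k.+1, h k.+1) (- D k, h k)); rewrite /cross /=.
- exact: floor_contact_wall.
- exact: floor_contact_right.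
- exact: (floor_contact_left (ltnW kK)).
- by lra.
- by nra.
- by lra.
Qed.

Lemma locked_middle k : (k <= K)%N -> locked L S (middle k).
Proof.
move=> kK; have [c c'] := cell_circle kK.
have [/andP[d1 _] /andP[h1 h2] /andP[x1 x2] /andP[y1 y2]] := cell_bounds kK.
apply: (@locked_by_contacts R L S _ (- D k, - h k) (D k, - h k) (X k - D k, Y k - h k)); rewrite /cross /=.
- by apply: (contact_point (floor_mem (leqW kK))) => /=; [ring|ring|rewrite -c; ring].
- by apply: (contact_point (floor_mem (k := k.+1) kK)) => /=; [rewrite wxS; ring|ring|rewrite -c; ring].
- by apply: (contact_point (upper_mem kK)) => //=; rewrite /ux; ring.
- by nra.
- by nra.
- by nra.
Qed.

Lemma upper_contact_middle k : (k <= K)%N ->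
  contact S (upper k) (D k - X k, h k - Y k).
Proof.
move=> kK; have [_ c] := cell_circle kK.
by apply: (contact_point (middle_mem kK)) => /=; [rewrite /ux; ring|ring|rewrite -c; ring].
Qed.

Lemma upper_contact_next k : (k < K)%N ->
  contact S (upper k) (X k.+1 + a k, Y k.+1 - Y k).
Proof.
move=> kK; apply: (contact_point (upper_mem kK)) => /=; [by rewrite uxS|ring|].
exact: (chain_edge H kK).
Qed.

Lemma upper_contact_prev k : (k < K)%N ->
  contact S (upper k.+1) (- (X k.+1 + a k), - (Y k.+1 - Y k)).
Proof.
move=> kK; apply: (contact_point (upper_mem (ltnW kK))) => /=; [by rewrite uxS //; ring|ring|].
by rewrite -(chain_edge H kK); ring.
Qed.

(** The mirror image in the diagonal acts as the preceding disc of the chain. *)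
Lemma locked_upper0 : locked L S (upper 0).
Proof.
have [e2 _ _ [s2l s2u] _] := sqrt_facts.
have [_ _ /andP[x1 x2] /andP[y1 y2]] := cell_bounds (leq0n K).
have m1 := chain_run H HK; have /andP[l1 l2] := chain_rise H HK.
have u0 : ux 0 = Y 0 + 1 + s2.
  by rewrite /ux (chain_start H) wx0 -/s6; ring.
apply: (@locked_by_contacts R L S _ (X 1 + a 0, Y 1 - Y 0) (- s2, s2) (D 0 - X 0, h 0 - Y 0)); rewrite /cross /=.
- exact: upper_contact_next.
- by apply: (contact_point (diag_mem (upper_mem (leq0n K)))) => /=; [rewrite u0; ring|rewrite u0; ring|ring: e2].
- exact: upper_contact_middle.
- by nra.
- by nra.
- by nra.
Qed.

Lemma locked_upperS k : (k.+1 < K)%N -> locked L S (upper k.+1).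
Proof.
move=> kK; have kK' := ltnW kK.
have [_ _ /andP[x1 x2] /andP[y1 y2]] := cell_bounds kK'.
have m1 := chain_run H kK; have /andP[l1 l2] := chain_rise H kK.
have m2 := chain_run H kK'; have /andP[l3 l4] := chain_rise H kK'.
have c1 := chain_edge H kK; have c2 := chain_edge H kK'; have cv := chain_convex H kK.
apply: (@locked_by_contacts R L S _ (X k.+2 + a k.+1, Y k.+2 - Y k.+1)
  (- (X k.+1 + a k), - (Y k.+1 - Y k)) (D k.+1 - X k.+1, h k.+1 - Y k.+1)); rewrite /cross /=.
- exact: upper_contact_next.
- exact: upper_contact_prev.
- exact: upper_contact_middle.
- move: (X k.+2 + a k.+1) (X k.+1 + a k) (Y k.+2 - Y k.+1) (Y k.+1 - Y k) m1 m2 c1 c2 l1 l2 l3 l4 cv.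
  move=> m m' l l' m1 m2 c1 c2 l1 l2 l3 l4 cv.
  (* Edges all have length 2, so the larger rise has the smaller run: the slope increases and the
     cross product is positive. *)
  have mm : m <= m' by nra.
  by nra.
- by nra.
- by nra.
Qed.

Lemma locked_upper_last : locked L S (upper K).
Proof.
have kK : (K.-1 < K)%N by rewrite ltn_predL.
have [_ cK] := cell_circle (leqnn K).
have [/andP[d1 _] _ /andP[x1 x2] /andP[y1 y2]] := cell_bounds (leqnn K).
have prev := upper_contact_prev kK; have m1 := chain_run H kK.
have /andP[l1 l2] := chain_rise H kK; rewrite prednK // in prev m1 l1 l2.
have x3 : 1 / 100 <= X K - D K by have := chain_end_gap H; rewrite /D; lra.
apply: (@locked_by_contacts R L S _ (- (X K + a K.-1), - (Y K - Y K.-1))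
  (D K - X K, h K - Y K) (Y K - h K, X K - D K)); rewrite /cross /=.
- exact: prev.
- exact: upper_contact_middle.
- apply: (contact_point (antidiag_mem (middle_mem (leqnn K)))) => /=; rewrite /L /side /ux; [ring|ring|].
  by rewrite -cK; ring.
- by nra.
- by nra.
(* The last edge is nearly horizontal: its run times the offset 1/100 outweighs its rise, at most
   1/400, times 2. *)
- have : 19 / 1000 <= (X K + a K.-1) * (X K - D K) by nra.
  have : (Y K - Y K.-1) * (Y K - h K) <= 1 / 200 by nra.
  by lra.
Qed.

Lemma locked_wedge : locked L S wedge.
Proof.
have [/andP[t1 t2] /andP[e1 e2] c c' te] := wedge_bounds.
have [/andP[d1 d2] /andP[h1 h2] _ _] := cell_bounds (leqnn K).
have wL := wedge_antidiag; rewrite /= in wL.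
have [_ _ e3 _ [_ _ s3l s3u]] := sqrt_facts.
apply: (@locked_by_contacts R L S _ (- (D K + t), h K - e) (- t, - e) (e, t)); rewrite /cross /=.
- by apply: (contact_point (middle_mem (leqnn K))) => /=; [rewrite wxS; ring|ring|rewrite -c'; ring].
- by apply: (contact_point (floor_mem (leqnn K.+1))) => /=; [ring|ring|rewrite -c; ring].
- apply: (contact_point (antidiag_mem (floor_mem (leqnn K.+1)))) => /=; [lra|lra|].
  by rewrite -c; ring.
- by nra.
- by nra.
(* Positive since [D K <= 27 / 20] and [7 / 5 <= h K]. *)
- rewrite (_ : _ - _ = h K ^+ 2 - D K ^+ 2); first by nra.
  by rewrite /t /e; field: e3.
Qed.

Lemma locked_base p : base_view p -> locked L S p.
Proof.
case=> [|||k kK|k kK|k kK].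
- exact: locked_corner.
- exact: locked_brace.
- exact: locked_wedge.
- exact: locked_floor.
- exact: locked_middle.
- move: kK; rewrite leq_eqVlt => /orP[/eqP->|kK]; first exact: locked_upper_last.
  by case: k kK => [|k] kK; [exact: locked_upper0 | exact: locked_upperS].
Qed.

(** * Counting the discs, and conclusion *)

Lemma size_base : size base = (3 * K + 7)%N.
Proof. by rewrite !size_cat !size_map !size_iota /=; lia. Qed.

Lemma size_mirrored_ge : (K <= size S)%N.
Proof.
have wx_lt (i j : nat) : (i < j)%N -> (j <= K)%N -> wx i < wx j.
  move=> ij jK; have := wx_mono ij (leqW jK); rewrite wxS.
  by have [/andP[d1 _] _ _ _] := cell_bounds (ltnW (leq_trans ij jK)); lra.
have u : uniq [seq floor k | k <- iota 0 K].
  rewrite map_inj_in_uniq ?iota_uniq // => i j.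
  rewrite !mem_iota !add0n => /andP[_ iK] /andP[_ jK] [eij].
  by case: (ltngtP i j) => // [ij|ji];
    [have := wx_lt i j ij (ltnW jK) | have := wx_lt j i ji (ltnW iK)]; rewrite eij ltxx.
have := uniq_leq_size u (s2 := S); rewrite size_map size_iota; apply.
move=> _ /mapP[k + ->]; rewrite mem_iota add0n => kK.
by apply: floor_mem; apply: leqW; apply: ltnW.
Qed.

Lemma wx_lower k : (k <= K)%N -> 2 * k%:R <= wx k.
Proof.
elim: k => [_|k IH kK]; first by rewrite wx0; have [_ _ _ [? ?] [? ? ? ?]] := sqrt_facts; lra.
rewrite wxS -natr1; have := IH (ltnW kK).
by have [/andP[d1 _] _ _ _] := cell_bounds (ltnW kK); lra.
Qed.

Lemma stable_chain : exists n : nat, (K <= n)%N /\ exists r : R,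
  [/\ 0 < r, r * n%:R <= 20 &
    exists x : 'I_n -> R * R, configuration r x /\ stable r x].
Proof.
have L2 : 2 * K%:R <= L by have := wx_lower (leqnn K); have := side_ge; lra.
have K1 : 1 <= K%:R :> R by rewrite ler1n.
have L0 : 0 < L by lra.
exists (size S); split; first exact: size_mirrored_ge.
exists L^-1; split; first by rewrite invr_gt0.
  rewrite mulrC ler_pdivrMr //.
  have : (size S)%:R <= (4 * (3 * K + 7))%:R :> R by rewrite ler_nat -size_base size_mirrored.
  (* The constant 20 comes from [4 * (3 * K + 7) <= 40 * K <= 20 * L], valid for [1 <= K]. *)
  by rewrite natrM natrD natrM; lra.
apply: stable_mirrored => //.
- by move=> p /baseP; apply: base_chamber.
- by move=> p /baseP; apply: base_ge1.
- exact: base_separated.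
- by move=> p /baseP; apply: locked_base.
Qed.

End Chain.

Theorem theorem1p2 (R : realType) :
  exists beta : R, 0 < beta /\
    forall N : nat, exists n : nat, (0 < n)%N /\ (N <= n)%N /\
      exists r : R, 0 < r /\ r <= beta / n%:R /\
        exists x : 'I_n -> R * R, configuration r x /\ stable r x.
Proof.
exists 20; split=> // N.
(* [K = N + 4] ensures [4 <= K], and [K <= n] will give [N <= n]. *)
have [X [Y [a H]]] := exists_chain R (leq_addl N 4).
have K0 : (0 < N + 4)%N by rewrite addnS.
have [n [Kn [r [r0 rn ex]]]] := stable_chain K0 H.
have n0 : (0 < n)%N by apply: leq_trans Kn.
exists n; do 2!split=> //; first by apply: leq_trans Kn; apply: leq_addr.
by exists r; do 2!split=> //; rewrite ler_pdivlMr ?ltr0n.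
Qed.
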